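(* There exists a positive real number $K$ such that, for every integer $b \ge 2$ and every integer $\ell \ge 2$, the following hold, where $f_\ell(b) = \prod_{h=0}^{\ell} (1 - b^{-2^h})$. (i) For every rational number $p/q$ (with $p, q$ integers, $q \ge 3$) different from $f_\ell(b)$, $$\Bigl| \prod_{h = 0}^\ell (1 - b^{-2^h}) - \frac{p}{q} \Bigr| > \frac{1}{q^2 \exp\bigl( K \log b \, \sqrt{\log q \, \log \log q}\bigr)}.$$ (ii) Writing the continued fraction expansion $f_\ell(b) = [0; a_1^{(\ell)}, a_2^{(\ell)}, \ldots, a_{\mathcal{L}(\ell)}^{(\ell)}]$ with $a_{\mathcal{L}(\ell)}^{(\ell)} \ge 2$, every partial quotient $a_j^{(\ell)}$ satisfies $$a_j^{(\ell)} \le b^{\,2K \sqrt{\ell}\, \sqrt{\log b \, \log\log (3b)}\; 2^{\ell/2}}.$$ (iii) There exists a positive real number $C$, depending only on $b$, such that the length $\mathcal{L}(\ell)$ of the continued fraction expansion of $f_\ell(b)$ satisfies $\mathcal{L}(\ell) > C\, 2^{\ell/2}/\sqrt{\ell}$.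
   Context: $f_\ell(b)$ is a rational number with denominator dividing $b^{2^{\ell+1}-1}$; its (finite) regular continued fraction expansion is $[0; a_1^{(\ell)}, \ldots, a_{\mathcal{L}(\ell)}^{(\ell)}]$ with positive integer partial quotients, normalized so that the last one is at least $2$. $\log$ denotes the natural logarithm. *)

(* Defs.v *)
From HB Require Import structures.
From mathcomp Require Import all_boot all_order all_algebra.
From mathcomp Require Import all_classical all_reals all_analysis.
From mathcomp Require Import lra.
Set Implicit Arguments.
Unset Strict Implicit.
Unset Printing Implicit Defensive.
Import Order.TTheory GRing.Theory Num.Theory.
Local Open Scope ring_scope.

Definition tm_prod (R : realType) (b l : nat) : R :=
  \prod_(0 <= h < l.+1) (1 - b%:R ^- (2 ^ h)).

(* cf_frac [:: a_1; ...; a_L] = [0; a_1, ..., a_L]; the integer part 0 is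
   not stored in the sequence. *)
Fixpoint cf_frac (R : realType) (a : seq nat) : R :=
  if a is a1 :: a' then (a1%:R + cf_frac R a')^-1 else 0.

(* The default 2 of [last] only matters for a = [::], the expansion of 0. *)
Definition regular_cf (R : realType) (x : R) (a : seq nat) : Prop :=
  [/\ all (fun n => 0 < n)%N a, (2 <= last 2 a)%N & x = cf_frac R a].

(* Existence and uniqueness of the normalized expansion of a rational number
   in [0, 1[, and the fact that they apply to tm_prod: statements about all a
   with regular_cf (tm_prod R b l) a are statements about exactly one a. *)

Lemma cf_frac_gt0 (R : realType) (a : seq nat) :
  all (fun n => 0 < n)%N a -> 0 <= cf_frac R a ?= iff (a == [::]).
Proof.
elim: a => [|a1 a IH] /=; first by split; rewrite ?lexx ?eqxx.
move=> /andP[a1_gt0 /IH[c0 _]].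
have d0 : 0 < a1%:R + cf_frac R a by rewrite ltr_wpDr ?ltr0n.
by split; [rewrite invr_ge0 ltW|rewrite eq_sym invr_eq0 gt_eqF].
Qed.

Lemma cf_frac_lt1 (R : realType) (a : seq nat) :
  all (fun n => 0 < n)%N a -> (2 <= last 2 a)%N -> cf_frac R a < 1.
Proof.
case: a => [|a1 a] /=; first by rewrite ltr01.
move=> /andP[a1_gt0 a_gt0] la.
have [c0 cE] := cf_frac_gt0 R a_gt0.
have a1R : 1 <= a1%:R :> R by rewrite ler1n.
rewrite invf_lt1; last by lra.
case: a la {a_gt0} c0 cE => [/= a1_ge2 _ _|a2 a _ c0 cE].
  by rewrite addr0 ltr1n.
have : 0 < cf_frac R (a2 :: a) by rewrite lt_def c0 andbT eq_sym cE.
by lra.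
Qed.

Lemma regular_cf_exists (R : realType) (m n : nat) :
  (m < n)%N -> exists a, regular_cf (m%:R / n%:R : R) a.
Proof.
elim/ltn_ind: m n => m IH n mn.
have [->|m_gt0] := posnP m; first by exists [::]; split; rewrite ?mul0r.
have mod_lt : (n %% m < m)%N by rewrite ltn_mod.
have [a [a_gt0 la aE]] := IH _ mod_lt _ mod_lt.
exists (n %/ m :: a)%N; split => /=.
- by rewrite a_gt0 andbT divn_gt0 // ltnW.
- case: a a_gt0 la aE => [|a2 a] //= _ _ /eqP.
  rewrite mulf_eq0 invr_eq0 !pnatr_eq0 (gtn_eqF m_gt0) orbF => /eqP n0.
  have := divn_eq n m; rewrite n0 addn0 => nE.
  by move: mn; rewrite {1}nE -{1}[m]mul1n ltn_pmul2r.
- rewrite -aE {1}(divn_eq n m) natrD natrM.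
  have mN0 : m%:R != 0 :> R by rewrite pnatr_eq0 -lt0n.
  rewrite -[in RHS](mulfK mN0 (n %/ m)%:R) -mulrDl invfM invrK mulrC //.
Qed.

Lemma regular_cf_uniq (R : realType) (x : R) (a a' : seq nat) :
  regular_cf x a -> regular_cf x a' -> a = a'.
Proof.
case=> a0 la ->; case=> a'0 la'.
elim: a a' a0 la a'0 la' => [|u a IH] [|v a'] // a0 la a'0 la' E.
- by have [_] := cf_frac_gt0 R a'0; rewrite -E /= eqxx.
- by have [_] := cf_frac_gt0 R a0; rewrite E /= eqxx.
have {}a0 : all (fun n => 0 < n)%N a by move: a0 => /= /andP[].
have {}a'0 : all (fun n => 0 < n)%N a' by move: a'0 => /= /andP[].
have {}la : (2 <= last 2 a)%N by case: a la {IH E a0}.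
have {}la' : (2 <= last 2 a')%N by case: a' la' {E a'0}.
have [c0 _] := cf_frac_gt0 R a0; have [c'0 _] := cf_frac_gt0 R a'0.
have c1 := cf_frac_lt1 R a0 la; have c'1 := cf_frac_lt1 R a'0 la'.
move: E => /= /invr_inj E.
have uv : u = v.
  apply/eqP; rewrite eqn_leq -ltnS -[(v <= u)%N]ltnS.
  by rewrite -!(ltr_nat R) -!natr1; apply/andP; split; lra.
by subst v; congr cons; apply: IH => //; apply: addrI E.
Qed.

Lemma regular_cf_tm_prod (R : realType) (b l : nat) :
  (2 <= b)%N -> exists a, regular_cf (tm_prod R b l) a.
Proof.
move=> b2.
suff [m [n [mn ->]]] : exists m n, (m < n)%N /\ tm_prod R b l = m%:R / n%:R.
  exact: regular_cf_exists.
have b_gt0 h : (0 < b ^ 2 ^ h)%N by rewrite expn_gt0 (ltnW b2).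
have factor h : (1 - b%:R ^- (2 ^ h) : R) = (b ^ 2 ^ h).-1%:R / (b ^ 2 ^ h)%:R.
  have bN0 : (b ^ 2 ^ h)%:R != 0 :> R by rewrite pnatr_eq0 -lt0n.
  by rewrite -subn1 natrB // mulrBl mulfV // mul1r natrX.
rewrite /tm_prod; elim: l => [|l [m [n [mn E]]]].
  by rewrite big_nat1 factor; do 2!eexists; split; [|reflexivity]; rewrite prednK.
rewrite big_nat_recr //= E factor.
exists (m * (b ^ 2 ^ l.+1).-1)%N, (n * b ^ 2 ^ l.+1)%N; split.
  by rewrite (leq_ltn_trans (leq_mul (leqnn m) (leq_pred _))) // ltn_pmul2r.
by rewrite !natrM invfM mulrACA.
Qed.

(* Main.v *)
Require Import Defs.
From HB Require Import structures.
From mathcomp Require Import all_boot all_order all_algebra.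
From mathcomp Require Import all_classical all_reals all_analysis.
From mathcomp Require Import zify ring lra.
Set Implicit Arguments.
Unset Strict Implicit.
Unset Printing Implicit Defensive.
Import Order.TTheory GRing.Theory Num.Theory.
Local Open Scope ring_scope.

(* Let G_j = \prod_(h <= j) (X^(2^h) - 1) and N = 2^(j+1). The rational
   function G_j / X^N has a normal Pade table: for every n <= N there are
   integer polynomials Q_n of degree n and P_n such that Q_n G_j - X^N P_n has
   degree exactly N - n - 1. They are built by induction on j from
   G_(j+1)(z) = (z - 1) G_j(z^2):
     Q_(2k)(z) = Q_k(z^2),
     Q_(2k+1)(z) = (z + 1) (u Q_(k+1) - v Q_k)(z^2) / (z^2 - 1),
   where u : v = Q_k(1) : Q_(k+1)(1). Nothing degenerates because Q_n(1) stays
   exactly divisible by 2, and the sum of the absolute values of the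
   coefficients of Q_n stays below 18^n.
   With B = b^(2^m) and l = m + j, evaluation at B gives integer linear forms
   in 1 and x = f_l(b) of coefficient at most (18 B)^n and value at most
   2 (18 / B)^n, two consecutive ones being independent. Choosing 2^m of the
   order of 1 + sqrt (log q) yields
     |x - p/q| > 1 / (q^2 exp (88 log b (1 + sqrt (log q)))),
   slightly more than (i). Applied to the convergents of x this bounds the
   partial quotients; since the reduced denominator b^(2^(l+1) - 1) of x is at
   most the product of the a_j + 1, the length is then bounded below. *)

(** * The l1 norm of integer polynomials and the substitution of [X^2] for [X] *)

Definition l1norm (p : {poly int}) : int := \sum_(i < size p) `|p`_i|.

Lemma l1norm_widen (p : {poly int}) n :
  (size p <= n)%N -> l1norm p = \sum_(i < n) `|p`_i|.
Proof.
move=> pn; rewrite /l1norm (big_ord_widen n (fun i => `|p`_i|)) // big_mkcond /=.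
apply: eq_bigr => i _; case: ltnP => // pi.
by rewrite nth_default // normr0.
Qed.

Lemma l1norm_ge0 p : 0 <= l1norm p.
Proof. by apply: sumr_ge0. Qed.

Lemma l1normD p q : l1norm (p + q) <= l1norm p + l1norm q.
Proof.
pose n := maxn (size p) (size q).
rewrite (@l1norm_widen (p + q) n) ?size_polyD //.
rewrite (@l1norm_widen p n) ?leq_maxl // (@l1norm_widen q n) ?leq_maxr //.
rewrite -big_split /=; apply: ler_sum => i _.
by rewrite coefD ler_normD.
Qed.

Lemma l1normZ c p : l1norm (c *: p) = `|c| * l1norm p.
Proof.
rewrite (@l1norm_widen (c *: p) (size p)) ?size_scale_leq // /l1norm mulr_sumr.
by apply: eq_bigr => i _; rewrite coefZ normrM.
Qed.

Lemma l1normN p : l1norm (- p) = l1norm p.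
Proof. by rewrite -scaleN1r l1normZ normrN1 mul1r. Qed.

Lemma l1normMXn p n : l1norm (p * 'X^n) = l1norm p.
Proof.
rewrite (@l1norm_widen _ (n + size p)); last first.
  by rewrite (leq_trans (size_polyMleq _ _)) // size_polyXn; lia.
rewrite big_split_ord /= big1 ?add0r => [|i _]; last first.
  by rewrite coefMXn ltn_ord normr0.
by apply: eq_bigr => i _; rewrite coefMXn ltnNge leq_addr /= addKn.
Qed.

Lemma l1norm_sum n (F : 'I_n -> {poly int}) :
  l1norm (\sum_(i < n) F i) <= \sum_(i < n) l1norm (F i).
Proof.
elim/big_ind2: _ => // [|p x q y px qy]; first by rewrite /l1norm size_poly0 big_ord0.
exact: le_trans (l1normD _ _) (lerD px qy).
Qed.

Lemma l1norm1 : l1norm 1 = 1.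
Proof. by rewrite /l1norm size_poly1 big_ord1 coef1. Qed.

Lemma l1normX2 p : l1norm (p \Po 'X^2) <= l1norm p.
Proof.
rewrite comp_polyE (le_trans (l1norm_sum _)) //; apply: ler_sum => i _.
by rewrite l1normZ -exprM -[_ ^+ (_ * _)]mul1r l1normMXn l1norm1 mulr1.
Qed.

Lemma l1norm_mulXD1 p : l1norm (('X + 1) * p) <= 2 * l1norm p.
Proof.
rewrite mulrDl mul1r (le_trans (l1normD _ _)) //.
by rewrite mulrC -['X]expr1 l1normMXn; lia.
Qed.

Lemma l1norm_horner p (x : int) :
  1 <= x -> `|p.[x]| <= l1norm p * x ^+ (size p).-1.
Proof.
move=> x1; rewrite horner_coef (le_trans (ler_norm_sum _ _ _)) // /l1norm mulr_suml.
apply: ler_sum => i _; rewrite normrM ler_wpM2l // normrX ger0_norm; last by lia.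
by apply: ler_weXn2l => //; have := ltn_ord i; lia.
Qed.

(** Division by [X - 1] forms partial sums: each coefficient of [S] is minus a partial sum of the
    coefficients of [T]. *)
Lemma l1norm_divXB1 (S T : {poly int}) :
  T = S * ('X - 1) -> l1norm S <= (size S)%:R * l1norm T.
Proof.
move=> TE.
have coefS i : S`_i = - \sum_(k < i.+1) T`_k.
  elim: i => [|i IH].
    by rewrite big_ord1 TE mulrBr mulr1 coefB coefMX /= sub0r opprK.
  by rewrite big_ord_recr /= opprD -IH TE mulrBr mulr1 coefB coefMX /= subKr.
rewrite {1}/l1norm (_ : _ * _ = \sum_(i < size S) l1norm T); last first.
  by rewrite sumr_const card_ord mulr_natl.
apply: ler_sum => i _; rewrite coefS normrN (le_trans (ler_norm_sum _ _ _)) //.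
rewrite (@l1norm_widen T (maxn i.+1 (size T))) ?leq_maxr //.
rewrite (big_ord_widen _ (fun k => `|T`_k|) (leq_maxl i.+1 (size T))) big_mkcond /=.
by apply: ler_sum => k _; case: ifP.
Qed.

Lemma coefM_le_l1norm (p G : {poly int}) n :
  (forall i, `|G`_i| <= 1) -> `|(p * G)`_n| <= l1norm p.
Proof.
move=> G1; rewrite coefM (le_trans (ler_norm_sum _ _ _)) //.
rewrite (@l1norm_widen p (maxn n.+1 (size p))) ?leq_maxr //.
rewrite (big_ord_widen _ (fun k => `|p`_k * G`_(n - k)|) (leq_maxl n.+1 (size p))).
rewrite big_mkcond /=; apply: ler_sum => k _; case: ifP => // _.
by rewrite normrM ler_piMr.
Qed.

Lemma compX2_eq0 (p : {poly int}) : (p \Po 'X^2 == 0) = (p == 0).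
Proof. by rewrite comp_poly_eq0 // size_polyXn. Qed.

Lemma size_compX2 (p : {poly int}) : size (p \Po 'X^2) = (size p).*2.-1.
Proof.
have [->|p0] := eqVneq p 0; first by rewrite comp_poly0 size_poly0.
have q0 : p \Po 'X^2 != 0 by rewrite compX2_eq0.
have := size_comp_poly p 'X^2; rewrite size_polyXn /=.
by move: p0 q0; rewrite -!size_poly_gt0; case: (size p) => [|m] //; case: (size _) => [|n] //=; lia.
Qed.

(** * Pade approximants *)

(** Up to a global sign, the generating polynomial of the first [2 ^ j.+1] terms of the Thue-Morse
    sequence with values 1 and -1. *)
Definition tm_poly j : {poly int} := \prod_(h < j.+1) ('X^(2 ^ h) - 1).

Lemma tm_poly0 : tm_poly 0 = 'X - 1.
Proof. by rewrite /tm_poly big_ord1 expr1. Qed.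

Lemma tm_polyS j : tm_poly j.+1 = ('X - 1) * (tm_poly j \Po 'X^2).
Proof.
rewrite /tm_poly big_ord_recl expr1; congr (_ * _).
rewrite (big_morph (fun p => p \Po 'X^2) (id1 := 1) (op1 := *%R)); last 2 first.
- by move=> p q; rewrite comp_polyM.
- by rewrite comp_polyC.
apply: eq_bigr => i _.
by rewrite comp_polyB comp_polyC comp_Xn_poly /= -exprM -expnS.
Qed.

(** In [(X - 1) q(X^2)] the two products occupy odd and even degrees respectively, so no two
    coefficients of [q] are ever added. *)
Lemma coef_tm_poly j i : `|(tm_poly j)`_i| <= 1.
Proof.
elim: j i => [|j IH] i; first by rewrite tm_poly0 coefB coefX coef1; case: i => [|[|?]].
rewrite tm_polyS mulrBl mul1r coefB coefXM !coef_comp_poly_Xn //.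
case: i => [|i] /=; first by rewrite sub0r normrN div0n.
rewrite !dvdn2 /=; by case: (odd i) => /=; rewrite ?sub0r ?subr0 ?normrN.
Qed.

Definition tm_rem j (Q P : {poly int}) := Q * tm_poly j - 'X^(2 ^ j.+1) * P.

(* The two congruences (Q(1) = 2 mod 4 and Q'(1) = n mod 2) drive the induction:
   Q_(2k+1)(1) = 2 (u Q_(k+1)'(1) - v Q_k'(1)) with u, v odd. The factor 9 n^2
   in the last field absorbs the factor 2 (k + 1) lost in each odd step. *)
Record tm_pade j n (Q P : {poly int}) : Prop := TmPade {
  pade_size : size Q = n.+1;
  pade_rem : size (tm_rem j Q P) = (2 ^ j.+1 - n)%N;
  pade_n0 : n = 0 -> Q = 1;
  pade_n1 : n = 1 -> Q = 'X + 1;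
  pade_val : (0 < n)%N -> exists c, Q.[1] = 2 * (2 * c + 1);
  pade_deriv : exists d, Q^`().[1] = n%:R + 2 * d;
  pade_l1 : (0 < n)%N -> 9 * n%:R ^+ 2 * l1norm Q <= 18 ^+ n }.

Lemma tm_pade_base n : (n <= 2)%N -> exists Q P, tm_pade 0 n Q P.
Proof.
have rem0 Q P : tm_rem 0 Q P = Q * ('X - 1) - 'X^2 * P by rewrite /tm_rem tm_poly0.
case: n => [|[|[|//]]] _.
- exists 1, 0; split => //; rewrite ?size_poly1 //.
  + by rewrite rem0 mul1r mulr0 subr0 -polyC1 size_XsubC.
  + by exists 0; rewrite derivC horner0.
- exists ('X + 1), 1; split => //.
  + by rewrite -polyC1 size_XaddC.
  + rewrite rem0 (_ : _ - _ = - 1) ?size_polyN ?size_poly1 //; ring.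
  + by exists 0; rewrite !hornerE.
  + by exists 0; rewrite derivD derivX derivC !hornerE.
  + move=> _; rewrite -[X in l1norm X]mulr1.
    by have := l1norm_mulXD1 1; rewrite l1norm1; lia.
(* Here [n] reaches [2 ^ j.+1], so the remainder is 0; the factor 2 serves the condition on
   [Q.[1]]. *)
- exists (2 *: 'X^2), (2 *: ('X - 1)); split => //.
  + by rewrite size_scale // size_polyXn.
  + rewrite rem0 -scalerAl -scalerAr subrr size_poly0 //.
  + by exists 0; rewrite !hornerE.
  + by exists 1; rewrite derivZ derivXn !hornerE.
  + by move=> _; rewrite l1normZ -['X^2]mul1r l1normMXn l1norm1.
Qed.

Lemma tm_rem_even j Q P :
  tm_rem j.+1 (Q \Po 'X^2) (('X - 1) * (P \Po 'X^2)) =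
  ('X - 1) * (tm_rem j Q P \Po 'X^2).
Proof.
rewrite /tm_rem tm_polyS comp_polyB !comp_polyM comp_Xn_poly -exprM -expnS; ring.
Qed.

(** The new factor [X + 1] and the factor [X - 1] of [tm_polyS] combine into [X^2 - 1], which undoes
    the division defining [S]. *)
Lemma tm_rem_odd j Q1 P1 Q2 P2 u v S :
  u *: Q2 - v *: Q1 = S * ('X - 1) ->
  tm_rem j.+1 (('X + 1) * (S \Po 'X^2)) ((u *: P2 - v *: P1) \Po 'X^2) =
  (u *: tm_rem j Q2 P2 - v *: tm_rem j Q1 P1) \Po 'X^2.
Proof.
move=> TE.
have -> : u *: tm_rem j Q2 P2 - v *: tm_rem j Q1 P1 =
    S * ('X - 1) * tm_poly j - 'X^(2 ^ j.+1) * (u *: P2 - v *: P1).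
  by rewrite -TE /tm_rem -!mul_polyC; ring.
rewrite /tm_rem tm_polyS !comp_polyB !comp_polyM !comp_polyB comp_Xn_poly comp_polyX.
rewrite comp_polyC -exprM -expnS; ring.
Qed.

Lemma horner_compX2_1 (p : {poly int}) : (p \Po 'X^2).[1] = p.[1].
Proof. by rewrite horner_comp hornerXn expr1n. Qed.

Lemma deriv_compX2_1 (p : {poly int}) : (p \Po 'X^2)^`().[1] = 2 * p^`().[1].
Proof.
by rewrite deriv_comp hornerM horner_comp derivXn !hornerE expr1n mulrC.
Qed.

Lemma size_subscale (p q : {poly int}) u v : u != 0 ->
  (size q < size p)%N -> size (u *: p - v *: q) = size p.
Proof.
move=> u0 qp; rewrite size_polyDl size_scale // size_polyN.
exact: leq_ltn_trans (size_scale_leq _ _) qp.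
Qed.

Lemma size_mulXB1 (p : {poly int}) : p != 0 -> size (('X - 1) * p) = (size p).+1.
Proof. by move=> p0; rewrite mulrC -polyC1 size_Mmonic ?monicXsubC // size_XsubC addn2. Qed.

Lemma tm_pade_even j k Q P : tm_pade j k Q P ->
  tm_pade j.+1 k.*2 (Q \Po 'X^2) (('X - 1) * (P \Po 'X^2)).
Proof.
case=> sQ sR Q0 _ Q1 [d dE] Ql; split; rewrite ?double_gt0.
- by rewrite size_compX2 sQ.
(* A zero remainder forces [2 ^ j.+1 <= k], and then both sides are 0. *)
- rewrite tm_rem_even; have [R0|R0] := eqVneq (tm_rem j Q P) 0.
    by move: sR; rewrite R0 comp_poly0 mulr0 size_poly0 (expnS 2 j.+1); lia.
  rewrite size_mulXB1; last by rewrite compX2_eq0.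
  by move: R0; rewrite size_compX2 -size_poly_gt0 sR (expnS 2 j.+1); lia.
- by case: k {sQ sR Q1 dE Ql} Q0 => // -> // _; rewrite comp_polyC.
- by case: k {sQ sR Q1 dE Ql Q0}.
- by move=> /Q1[c cE]; exists c; rewrite horner_compX2_1.
- by exists (Q^`().[1] - k%:R); rewrite deriv_compX2_1 -muln2 natrM; ring.
- move=> k0; have {}Ql := Ql k0; rewrite -mul2n natrM mul2n -muln2 exprM.
  have l := l1normX2 Q; have l0 := l1norm_ge0 (Q \Po 'X^2).
  (* Doubling the index multiplies its square by 4, whereas [18 ^ k] gets squared. *)
  have a18 : (4 : int) <= 18 ^+ k.
    have : (1 : int) <= 18 ^+ k.-1 by exact: exprn_ege1.
    by rewrite -{2}(prednK k0) exprS; lia.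
  have Ql' : 9 * k%:R ^+ 2 * l1norm (Q \Po 'X^2) <= 18 ^+ k.
    by apply: le_trans Ql; rewrite ler_wpM2l // mulr_ge0 // sqr_ge0.
  nia.
Qed.

(** The remainder of index [k] has the larger degree and a nonzero weight [v], so its leading term
    survives. *)
Lemma size_tm_rem_odd j k Q1 P1 Q2 P2 u v S : (k < 2 ^ j.+1)%N ->
  tm_pade j k Q1 P1 -> tm_pade j k.+1 Q2 P2 -> v != 0 ->
  u *: Q2 - v *: Q1 = S * ('X - 1) ->
  size (tm_rem j.+1 (('X + 1) * (S \Po 'X^2)) ((u *: P2 - v *: P1) \Po 'X^2)) =
  (2 ^ j.+2 - k.*2.+1)%N.
Proof.
move=> kN [_ sR1 _ _ _ _ _] [_ sR2 _ _ _ _ _] v0 TE.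
rewrite (tm_rem_odd j P1 P2 TE) size_compX2 -size_polyN opprB size_subscale //; last first.
  by rewrite sR1 sR2; lia.
by rewrite sR1 (expnS 2 j.+1); lia.
Qed.

(** The odd step for [k = 0] is apart because [Q_0(1) = 1] is odd. The weights [1 = Q_0(1)] and
    [2 = Q_1(1)] give [S = 1]. *)
Lemma tm_pade_odd1 j P1 Q2 P2 : tm_pade j 0 1 P1 -> tm_pade j 1 Q2 P2 ->
  tm_pade j.+1 1 ('X + 1) ((1 *: P2 - 2 *: P1) \Po 'X^2).
Proof.
move=> p1 p2; have Q2E := pade_n1 p2 erefl; subst Q2.
have TE : 1 *: ('X + 1) - 2 *: 1 = 1 * ('X - 1) :> {poly int}.
  by rewrite -!mul_polyC; ring.
have := @size_tm_rem_odd j 0 _ _ _ _ 1 2 1 (expn_gt0 2 _) p1 p2 isT TE.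
rewrite comp_polyC mulr1 => sR; split => //.
- by rewrite -polyC1 size_XaddC.
- by exists 0; rewrite !hornerE.
- by exists 0; rewrite derivD derivX derivC !hornerE.
- exact: pade_l1 p2.
Qed.

(** The weights [U] and [V] are the odd halves of the values at 1. The combination vanishes at 1 and
    [S.[1]] is its derivative there, congruent to [U (k + 1) - V k] modulo 2, hence odd; the new
    value at 1 is [2 S.[1]]. *)
Lemma tm_pade_odd j k Q1 P1 Q2 P2 : (0 < k < 2 ^ j.+1)%N ->
  tm_pade j k Q1 P1 -> tm_pade j k.+1 Q2 P2 ->
  exists Q P, tm_pade j.+1 k.*2.+1 Q P.
Proof.
case/andP=> k0 kN p1 p2.
have [u uE] := pade_val p1 k0; have [v vE] := pade_val p2 isT.
have [d dE] := pade_deriv p1; have [e eE] := pade_deriv p2.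
pose U := 2 * u + 1; pose V := 2 * v + 1.
have U0 : U != 0 by rewrite /U; lia.
have V0 : V != 0 by rewrite /V; lia.
have sT : size (U *: Q2 - V *: Q1) = k.+2.
  by rewrite size_subscale // ?(pade_size p1) (pade_size p2).
have [S TE] : exists S : {poly int}, U *: Q2 - V *: Q1 = S * ('X - 1).
  have /factor_theorem[S ->] : root (U *: Q2 - V *: Q1) 1.
    by rewrite rootE !hornerE uE vE /U /V; apply/eqP; ring.
  by exists S; rewrite polyC1.
have S0 : S != 0.
  by apply: contra_eqN sT => /eqP S0; rewrite TE S0 mul0r size_poly0.
have sS : size S = k.+1.
  by move: sT; rewrite TE mulrC size_mulXB1 // => -[].
have S1 : S.[1] = U * (k.+1%:R + 2 * e) - V * (k%:R + 2 * d).
  have := congr1 (fun p => p^`().[1]) TE; rewrite derivM !derivB derivX derivC.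
  by rewrite !derivZ !hornerE dE eE => <-.
exists (('X + 1) * (S \Po 'X^2)), ((U *: P2 - V *: P1) \Po 'X^2); split=> //.
- rewrite mulrC -polyC1 size_Mmonic ?monicXaddC ?compX2_eq0 // size_XaddC.
  by rewrite size_compX2 sS; lia.
- exact: (size_tm_rem_odd kN p1 p2 V0 TE).
- by case: k k0 {kN p1 p2 dE eE sT sS S1}.
(* The witness is [(S.[1] - 1) / 2]. *)
- exists (u * (k.+1%:R + 2 * e) + e - v * (k%:R + 2 * d) - d).
  rewrite hornerM horner_compX2_1 !hornerE S1 /U /V -natr1; ring.
- exists (u * (k.+1%:R + 2 * e) + e - v * (k%:R + 2 * d) - d + 2 * S^`().[1] - k%:R).
  rewrite derivM derivD derivX derivC !hornerE horner_compX2_1 deriv_compX2_1 S1.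
  rewrite /U /V -natr1 -[k.*2.+1%:R]natr1 -muln2 natrM -natr1; ring.
move=> _.
have l1 := pade_l1 p1 k0; have l2 := pade_l1 p2 isT.
(* As the weights are half the values at 1, the norm of the combination is at most the product of
   the two norms, without a constant. *)
have a1 : 2 * `|U| <= l1norm Q1.
  by have := l1norm_horner Q1 (lexx 1); rewrite expr1n mulr1 uE -/U normrM.
have a2 : 2 * `|V| <= l1norm Q2.
  by have := l1norm_horner Q2 (lexx 1); rewrite expr1n mulr1 vE -/V normrM.
have lT : l1norm (U *: Q2 - V *: Q1) <= l1norm Q1 * l1norm Q2.
  have := l1normD (U *: Q2) (- (V *: Q1)); rewrite l1normN !l1normZ.
  have := ler_wpM2r (l1norm_ge0 Q2) a1; have := ler_wpM2l (l1norm_ge0 Q1) a2.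
  lra.
have lS := l1norm_divXB1 TE; rewrite sS in lS.
have lQ : l1norm (('X + 1) * (S \Po 'X^2)) <= 2 * k.+1%:R * (l1norm Q1 * l1norm Q2).
  apply: le_trans (l1norm_mulXD1 _) _; rewrite -mulrA ler_wpM2l //.
  apply: le_trans (l1normX2 _) _; apply: le_trans lS _; rewrite ler_wpM2l //.
have l12 := ler_pM _ _ l1 l2; rewrite -exprD in l12.
rewrite (_ : (k + k.+1)%N = k.*2.+1) in l12; last by lia.
apply: le_trans (l12 _ _); first last.
- by rewrite !mulr_ge0 ?exprn_ge0 ?l1norm_ge0.
- by rewrite !mulr_ge0 ?exprn_ge0 ?l1norm_ge0.
apply: le_trans (ler_wpM2l _ lQ) _; first by rewrite mulr_ge0 ?exprn_ge0.
set L := l1norm Q1 * l1norm Q2.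
have L0 : 0 <= L by rewrite mulr_ge0 ?l1norm_ge0.
rewrite [leRHS](_ : _ = 81 * (k%:R ^+ 2 * k.+1%:R ^+ 2) * L); last first.
  by rewrite /L; ring.
rewrite [leLHS](_ : _ = 18 * (k.*2.+1%:R ^+ 2 * k.+1%:R) * L); last by ring.
apply: ler_wpM2r => //.
rewrite -!natrX -!natrM; move: k0; clear; move=> k0.
suff : (18 * (k.*2.+1 ^ 2 * k.+1) <= 81 * (k ^ 2 * k.+1 ^ 2))%N by rewrite -(ler_nat int) !natrM.
have h : (k.*2.+1 <= 3 * k)%N by lia.
have h2 : (k.*2.+1 ^ 2 <= 9 * k ^ 2)%N by nia.
have h3 : (18 <= 9 * k.+1)%N by lia.
rewrite -!mulnn in h2 *; nia.
Qed.

Lemma tm_pade_exists j n : (n <= 2 ^ j.+1)%N -> exists Q P, tm_pade j n Q P.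
Proof.
elim: j n => [|j IH] n nN; first exact: tm_pade_base.
rewrite expnS in nN; rewrite -(odd_double_half n) in nN *; move: n./2 nN => k.
case: odd => /=; rewrite ?add0n ?add1n => kN; last first.
  have [|Q [P QP]] := IH k; first by lia.
  by do 2 eexists; exact: tm_pade_even QP.
have [|Q1 [P1 p1]] := IH k; first by lia.
have [|Q2 [P2 p2]] := IH k.+1; first by lia.
have [k0|k0] := posnP k; last first.
  by apply: tm_pade_odd p1 p2; rewrite k0; lia.
subst k; have Q1E := pade_n0 p1 erefl; rewrite Q1E in p1.
by do 2 eexists; exact: tm_pade_odd1 p1 p2.
Qed.

Lemma tm_pade_l1 j n Q P : tm_pade j n Q P -> l1norm Q <= 18 ^+ n.
Proof.
move=> p; case: n p => [|n] p; first by rewrite (pade_n0 p erefl) l1norm1.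
apply: le_trans (pade_l1 p isT); rewrite ler_peMl ?l1norm_ge0 //.
have : (1 : int) <= n.+1%:R ^+ 2 by rewrite exprn_ege1 // ler1n.
by lia.
Qed.

(* The polynomial Q1 P2 - Q2 P1 is a nonzero constant. *)
Lemma tm_pade_det j n Q1 P1 Q2 P2 (B : int) : (n < 2 ^ j.+1)%N ->
  tm_pade j n Q1 P1 -> tm_pade j n.+1 Q2 P2 ->
  Q1.[B] * P2.[B] - Q2.[B] * P1.[B] != 0.
Proof.
move=> nN p1 p2.
have E : 'X^(2 ^ j.+1) * (Q1 * P2 - Q2 * P1) =
    Q2 * tm_rem j Q1 P1 - Q1 * tm_rem j Q2 P2 by rewrite /tm_rem; ring.
have R1 : tm_rem j Q1 P1 != 0 by rewrite -size_poly_gt0 (pade_rem p1); lia.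
have Q20 : Q2 != 0 by rewrite -size_poly_gt0 (pade_size p2).
have Q10 : Q1 != 0 by rewrite -size_poly_gt0 (pade_size p1).
(* With [N = 2 ^ j.+1], the first product has degree [(n + 1) + (N - n - 1) = N] and the second a
   smaller one; so the determinant, multiplied by [X^N], has degree [N]. *)
have s1 : size (Q2 * tm_rem j Q1 P1) = (2 ^ j.+1).+1.
  by rewrite size_mul // (pade_size p2) (pade_rem p1); lia.
have s2 : (size (Q1 * tm_rem j Q2 P2)%R < (2 ^ j.+1).+1)%N.
  have [->|R2] := eqVneq (tm_rem j Q2 P2) 0; first by rewrite mulr0 size_poly0.
  by rewrite size_mul // (pade_size p1) (pade_rem p2); lia.
have := congr1 (fun p : {poly int} => size p) E.
rewrite (size_polyDl (q := - _)) ?size_polyN s1 // => s3.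
have D0 : Q1 * P2 - Q2 * P1 != 0.
  by apply: contra_eqN s3 => /eqP->; rewrite mulr0 size_poly0.
move: s3; rewrite size_monicM ?monicXn // size_polyXn => s3.
have /eqP/size_poly1P[c c0 cE] : size (Q1 * P2 - Q2 * P1) = 1 by lia.
by rewrite -!hornerM -hornerN -hornerD cE hornerC.
Qed.

Lemma tm_pade_value j n Q P (B : int) : tm_pade j n Q P -> 1 <= B ->
  `|Q.[B]| <= 18 ^+ n * B ^+ n.
Proof.
move=> p B1; apply: le_trans (l1norm_horner Q B1) _.
rewrite (pade_size p) /= ler_wpM2r ?exprn_ge0 ?(tm_pade_l1 p) //; lia.
Qed.

Lemma geometric_le (B : int) n : 2 <= B -> B * \sum_(i < n) B ^+ i <= 2 * B ^+ n.
Proof.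
move=> B2; elim: n => [|n IH]; first by rewrite big_ord0 mulr0.
rewrite big_ord_recr exprS mulrDr /=; apply: le_trans (lerD IH (lexx _)) _.
have : 0 <= B ^+ n by rewrite exprn_ge0 //; lia.
nia.
Qed.

(** Below degree [2 ^ j.+1] the remainder has the coefficients of [Q * tm_poly j]. The factor [B] on
    the left will pay for [b * tm_num b m <= B] in [tm_form]. *)
Lemma tm_pade_rem_value j n Q P (B : int) : tm_pade j n Q P -> 2 <= B ->
  B * `|(tm_rem j Q P).[B]| <= 2 * 18 ^+ n * B ^+ (2 ^ j.+1 - n).
Proof.
move=> p B2; rewrite horner_coef (pade_rem p) [2 * _]mulrC -mulrA.
apply: le_trans (ler_wpM2l (exprn_ge0 _ _) (geometric_le _ B2)); last by [].
rewrite mulrCA; apply: ler_wpM2l; first by lia.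
apply: le_trans (ler_norm_sum _ _ _) _.
rewrite mulr_sumr; apply: ler_sum => i _; rewrite normrM normrX (ger0_norm (x := B)); last by lia.
apply: ler_wpM2r; first by rewrite exprn_ge0 //; lia.
apply: le_trans (tm_pade_l1 p).
rewrite /tm_rem coefB coefXnM (leq_trans (ltn_ord i)) ?leq_subr // subr0.
exact: coefM_le_l1norm (coef_tm_poly j).
Qed.

(** * Integer linear forms in 1 and tm_prod *)

(** The index counts factors: [tm_num b l.+1] is the numerator of [tm_prod R b l] over
    [b ^ (2 ^ l.+1 - 1)]. *)
Definition tm_num (b m : nat) : int := \prod_(h < m) (b%:R ^+ (2 ^ h) - 1).

Lemma tm_prod_num (R : realType) (b l : nat) : (2 <= b)%N ->
  tm_prod R b l * b%:R ^+ (2 ^ l.+1) = b%:R * (tm_num b l.+1)%:~R.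
Proof.
move=> b2; have b0 n : b%:R ^+ n != 0 :> R by rewrite expf_neq0 // pnatr_eq0; lia.
have factor h : (1 - b%:R ^- (2 ^ h)) * b%:R ^+ (2 ^ h) =
    ((b%:R ^+ (2 ^ h) - 1 : int)%:~R : R).
  by rewrite mulrBl mulVf // mul1r rmorphB rmorphXn /= rmorph1 natz pmulrn.
rewrite /tm_prod /tm_num; elim: l => [|l IH].
  by rewrite big_nat1 big_ord1 -factor !expn0 !expr1 expr2; ring.
rewrite big_nat_recr //= big_ord_recr /= rmorphM /= -(factor l.+1) mulrA -IH.
by rewrite [(2 ^ l.+2)%N]expnS mul2n -addnn exprD; ring.
Qed.

Lemma tm_num_gt0 b m : (2 <= b)%N -> 0 < tm_num b m.
Proof.
move=> b2; apply: prodr_gt0 => h _; by rewrite subr_gt0 exprn_egt1 ?ltr1n // -lt0n expn_gt0.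
Qed.

Lemma tm_num_le b m : (2 <= b)%N -> b%:R * tm_num b m <= b%:R ^+ (2 ^ m).
Proof.
move=> b2; rewrite /tm_num; elim: m => [|m IH]; first by rewrite big_ord0 mulr1 expr1.
rewrite big_ord_recr /= mulrA expnS mul2n -addnn exprD.
have B0 : (1 : int) <= b%:R ^+ (2 ^ m) by rewrite exprn_ege1 // ler1n; lia.
by apply: ler_pM => //; rewrite ?mulr_ge0 ?(ltW (tm_num_gt0 _ b2)) //; lia.
Qed.

Lemma tm_num_split b m j :
  tm_num b (m + j.+1) = tm_num b m * (tm_poly j).[b%:R ^+ (2 ^ m)].
Proof.
rewrite /tm_num big_split_ord /= /tm_poly horner_prod; congr (_ * _).
by apply: eq_bigr => h _; rewrite !hornerE -exprM -expnD.
Qed.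

(** With [N = 2 ^ j.+1], [tm_prod R b (m + j)] is [b * tm_num b m * (tm_poly j).[B] / B ^ N]: the
    first [m] factors become an integer multiplier, and the error is this multiplier times the Pade
    remainder over [B ^ N]. *)
Lemma tm_form (R : realType) (b m j n : nat) (B : int) Q P : (2 <= b)%N ->
  B = b%:R ^+ (2 ^ m) -> (n <= 2 ^ j.+1)%N -> tm_pade j n Q P ->
  `| Q.[B]%:~R * tm_prod R b (m + j) - (b%:R * tm_num b m * P.[B])%:~R | *
    B%:~R ^+ n <= 2 * 18 ^+ n.
Proof.
move=> b2 defB nN p.
have B2 : 2 <= B.
  rewrite defB -(prednK (expn_gt0 2 m : 0 < 2 ^ m)%N) exprS.
  have : (1 : int) <= b%:R ^+ (2 ^ m).-1 by rewrite exprn_ege1 // ler1n; lia.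
  have : (2 : int) <= b%:R by rewrite ler_nat.
  by nia.
have BR n' : 0 < B%:~R ^+ n' :> R by rewrite exprn_gt0 // ltr0z; lia.
rewrite -(ler_pM2r (BR (2 ^ j.+1 - n)%N)) -[leLHS]mulrA -exprD subnKC //.
rewrite -[X in _ * X](gtr0_norm (BR _)) -normrM.
have -> : (Q.[B]%:~R * tm_prod R b (m + j) - (b%:R * tm_num b m * P.[B])%:~R) *
    B%:~R ^+ (2 ^ j.+1) = ((b%:R * tm_num b m * (tm_rem j Q P).[B])%:~R : R).
  have BE : B%:~R ^+ (2 ^ j.+1) = b%:R ^+ (2 ^ (m + j).+1) :> R.
    by rewrite defB rmorphXn /= natz -exprM -expnD addnS pmulrn.
  rewrite mulrBl -mulrA {1}BE tm_prod_num // -addnS tm_num_split -defB.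
  rewrite /tm_rem !hornerE !(rmorphM, rmorphB, rmorphXn) /= !natz !pmulrn; ring.
have W0 : 0 <= b%:R * tm_num b m by rewrite mulr_ge0 // ltW // tm_num_gt0.
rewrite -intr_norm normrM (ger0_norm W0).
have h : b%:R * tm_num b m * `|(tm_rem j Q P).[B]| <= 2 * 18 ^+ n * B ^+ (2 ^ j.+1 - n).
  by apply: le_trans (tm_pade_rem_value p B2); rewrite ler_wpM2r // defB tm_num_le.
by rewrite -(ler_int R) in h; apply: le_trans h _; rewrite !(rmorphM, rmorphXn) /=.
Qed.

(** * From integer linear forms to lower bounds for the distance to [p / q] *)

Lemma frac_lower_bound (R : realType) (x H : R) (p X Y : int) (q : nat) : (0 < q)%N ->
  X * p != Y * q%:R -> `|X%:~R| <= H -> q%:R * `|X%:~R * x - Y%:~R| <= 1 / 2 ->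
  1 <= 2 * H * q%:R * `|x - p%:~R / q%:R|.
Proof.
move=> q0 XY XH e.
have q0R : 0 < q%:R :> R by rewrite ltr0n.
have i1 : 1 <= `|(X * p - Y * q%:R)%:~R : R|.
  by rewrite -intr_norm ler1z; move: XY; rewrite -subr_eq0; lia.
(* A nonzero integer is split into the small form, which contributes at most 1/2, and a multiple of
   the distance. *)
have : `|(X * p - Y * q%:R)%:~R : R| <=
    q%:R * `|X%:~R * x - Y%:~R| + H * q%:R * `|x - p%:~R / q%:R|.
  have -> : (X * p - Y * q%:R)%:~R =
     q%:R * (X%:~R * x - Y%:~R) + - (X%:~R * q%:R * (x - p%:~R / q%:R)) :> R.
    rewrite rmorphB !rmorphM /= natz -pmulrn; field.
    by rewrite gt_eqF.
  apply: le_trans (ler_normD _ _) _; rewrite normrN !normrM !(gtr0_norm q0R).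
  by rewrite lerD2l !ler_wpM2r.
lra.
Qed.

(** Two independent forms cannot both vanish at [p / q]; the one that does not vanish is used. *)
Lemma frac_lower_bound2 (R : realType) (x H1 H2 : R) (p X1 Y1 X2 Y2 : int) (q : nat) :
  (0 < q)%N -> X1 * Y2 - X2 * Y1 != 0 -> `|X1%:~R| <= H1 -> `|X2%:~R| <= H2 ->
  H1 <= H2 ->
  q%:R * `|X1%:~R * x - Y1%:~R| <= 1 / 2 -> q%:R * `|X2%:~R * x - Y2%:~R| <= 1 / 2 ->
  1 <= 2 * H2 * q%:R * `|x - p%:~R / q%:R|.
Proof.
move=> q0 det h1 h2 h12 e1 e2.
have [E1|E1] := eqVneq (X1 * p) (Y1 * q%:R); last first.
  exact: frac_lower_bound q0 E1 (le_trans h1 h12) e1.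
apply: (frac_lower_bound q0 _ h2 e2); apply: contra_neq det => E2.
have q0Z : (q%:R : int) != 0 by rewrite pnatr_eq0 -lt0n.
(* The elimination below cancels [p], so [p = 0] is treated first. *)
have [p0|p0] := eqVneq p 0.
  move: E1 E2; rewrite p0 !mulr0 => /esym/eqP; rewrite mulf_eq0 (negPf q0Z) orbF.
  move=> /eqP-> /esym/eqP; rewrite mulf_eq0 (negPf q0Z) orbF => /eqP->; ring.
apply: (mulfI p0); apply: (mulfI q0Z).
have -> : q%:R * (p * (X1 * Y2 - X2 * Y1)) =
  (X1 * p) * (Y2 * q%:R) - (X2 * p) * (Y1 * q%:R) by ring.
by rewrite E1 E2; ring.
Qed.

(** Distinct fractions differ by at least the inverse product of their denominators. This serves
    when the Pade forms are exhausted. *)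
Lemma frac_trivial_bound (R : realType) (b l : nat) (p : int) (q : nat) :
  (2 <= b)%N -> (0 < q)%N -> p%:~R / q%:R <> tm_prod R b l ->
  1 <= q%:R * b%:R ^+ (2 ^ l.+1) * `|tm_prod R b l - p%:~R / q%:R|.
Proof.
move=> b2 q0 ne.
have q0R : 0 < q%:R :> R by rewrite ltr0n.
have v0 : 0 < b%:R ^+ (2 ^ l.+1) :> R by rewrite exprn_gt0 // ltr0n; lia.
have E : q%:R * b%:R ^+ (2 ^ l.+1) * (tm_prod R b l - p%:~R / q%:R) =
   (q%:R * (b%:R * tm_num b l.+1) - p * b%:R ^+ (2 ^ l.+1))%:~R.
  rewrite mulrBr -mulrA [_ * tm_prod _ _ _]mulrC tm_prod_num //.
  rewrite rmorphB !rmorphM rmorphXn /= !natz -!pmulrn; field.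
  by rewrite gt_eqF.
rewrite -[X in X * `|_|]gtr0_norm ?mulr_gt0 // -normrM E -intr_norm ler1z.
suff : q%:R * (b%:R * tm_num b l.+1) - p * b%:R ^+ (2 ^ l.+1) != 0 by lia.
apply: contra_not_neq ne => E0; apply/esym/subr0_eq; move: E; rewrite E0 => /eqP.
by rewrite mulf_eq0 gt_eqF ?mulr_gt0 //= => /eqP.
Qed.

(** The last hypothesis makes [2 (18 / B)^n] at most [1 / (2 q)], with [B = b ^ 2 ^ m]; since
    [18 <= B], the form of index [n + 1] is small enough too. *)
Lemma tm_lower_step (R : realType) (b m j n : nat) (p : int) (q : nat) :
  (2 <= b)%N -> (18 <= b ^ 2 ^ m)%N -> (0 < q)%N -> (n < 2 ^ j.+1)%N ->
  (4 * q * 18 ^ n <= (b ^ 2 ^ m) ^ n)%N ->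
  1 <= 2 * (18 * b%:R ^+ (2 ^ m)) ^+ n.+1 * q%:R *
    `|tm_prod R b (m + j) - p%:~R / q%:R|.
Proof.
move=> b2 B18 q0 nN cond.
have [|Q1 [P1 p1]] := @tm_pade_exists j n; first exact: ltnW.
have [|Q2 [P2 p2]] := @tm_pade_exists j n.+1; first exact: nN.
pose B : int := b%:R ^+ (2 ^ m).
have BE : B%:~R = (b ^ 2 ^ m)%:R :> R by rewrite /B -natrX natz pmulrn.
have B1 : 1 <= B by rewrite /B -natrX ler1n expn_gt0; lia.
have f1 := tm_form R b2 (erefl B) (ltnW nN) p1.
have f2 := tm_form R b2 (erefl B) nN p2.
have v1 := tm_pade_value p1 B1; have v2 := tm_pade_value p2 B1.
have det := tm_pade_det B nN p1 p2.
rewrite -/B in f1 f2.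
have B18R : 18 <= B%:~R :> R by rewrite BE ler_nat.
have condR : 4 * q%:R * 18 ^+ n <= B%:~R ^+ n :> R.
  by rewrite BE -!natrX -!natrM ler_nat.
have c1 : 1 <= 18 ^+ n :> R by rewrite exprn_ege1 // ler1n.
have q1 : 1 <= q%:R :> R by rewrite ler1n.
have Bn0 : 0 < B%:~R ^+ n :> R by rewrite exprn_gt0 //; lra.
have -> : b%:R ^+ (2 ^ m) = B%:~R :> R by rewrite BE natrX.
have D0 : (Q1.[B] * (b%:R * tm_num b m * P2.[B]) -
           Q2.[B] * (b%:R * tm_num b m * P1.[B])) != 0.
  rewrite mulrCA [Q2.[B] * _]mulrCA -mulrBr mulf_neq0 // mulf_neq0 ?pnatr_eq0 //.
    by rewrite -lt0n; lia.
  by rewrite gt_eqF // tm_num_gt0.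
apply: (frac_lower_bound2 (H1 := (18 * B%:~R) ^+ n) p q0 D0).
- by rewrite exprMn -intr_norm; rewrite -(ler_int R) in v1; apply: le_trans v1 _;
    rewrite !(rmorphM, rmorphXn).
- by rewrite exprMn -intr_norm; rewrite -(ler_int R) in v2; apply: le_trans v2 _;
    rewrite !(rmorphM, rmorphXn).
- by rewrite ler_weXn2l //; lra.
- set e := `|_| in f1 *; rewrite -(ler_pM2r Bn0).
  have := ler_wpM2l (ler0n R q) f1; lra.
- set e := `|_| in f2 *; have B0 : 0 < B%:~R ^+ n.+1 :> R by rewrite exprn_gt0 //; lra.
  rewrite -(ler_pM2r B0).
  have := ler_wpM2l (ler0n R q) f2; rewrite ![_ ^+ n.+1]exprS.
  have := ler_wpM2l (ler0n R 18) condR.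
  have := ler_wpM2r (ltW Bn0) B18R; lra.
Qed.

(** The least index [n] satisfying the condition of [tm_lower_step] is used. Its failure at [n - 1],
    the [t] of the statement, bounds [B ^ t] in terms of [q]. *)
Lemma tm_lower (R : realType) (b m l : nat) (p : int) (q : nat) :
  (2 <= b)%N -> (m <= l)%N -> (36 <= b ^ 2 ^ m)%N -> (0 < q)%N ->
  p%:~R / q%:R <> tm_prod R b l ->
  exists t : nat, ((b ^ 2 ^ m) ^ t <= 4 * q * 18 ^ t)%N /\
    1 <= 8 * q%:R ^+ 2 * 18 ^+ (2 * t.+1) * (b%:R ^+ (2 ^ m)) ^+ 2 *
      `|tm_prod R b l - p%:~R / q%:R|.
Proof.
move=> b2 ml B36 q0 ne; pose j := (l - m)%N.
have lE : l = (m + j)%N by rewrite /j subnKC.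
(* The value 36 is [2 * 18]: the ratio [B / 18] is at least 2, and [4 q < 2 ^ (4 q)]. *)
have exT : exists t, (4 * q * 18 ^ t <= (b ^ 2 ^ m) ^ t)%N.
  exists (4 * q)%N; apply: leq_trans (_ : (2 * 18) ^ (4 * q) <= _)%N.
    by rewrite expnMn leq_mul2r ltnW ?orbT // ltn_expl.
  by rewrite leq_exp2r //; lia.
case: (ex_minnP exT) => t ct tmin.
have t0 : (0 < t)%N by case: t ct {tmin} => //; lia.
have below s : (s < t)%N -> ((b ^ 2 ^ m) ^ s <= 4 * q * 18 ^ s)%N.
  by move=> st; rewrite leqNgt; apply: contraL st => /ltnW/tmin; rewrite -leqNgt.
have natB : b%:R ^+ (2 ^ m) = (b ^ 2 ^ m)%:R :> R by rewrite natrX.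
set d := `|_ - _|; have d0 : 0 <= d by rewrite normr_ge0.
rewrite natB; move: (b ^ 2 ^ m)%N natB B36 ct below => B natB B36 ct below.
have [tN|tN] := ltnP t (2 ^ j.+1).
  exists t.-1; rewrite prednK //; split; first by apply: below; rewrite prednK.
  have BN : (18 <= b ^ 2 ^ m)%N.
    by rewrite -(ler_nat R) natrX natB ler_nat; lia.
  have cond : (4 * q * 18 ^ t <= (b ^ 2 ^ m) ^ t)%N.
    by rewrite -(ler_nat R) [leRHS]natrX [X in _ <= X ^+ _]natrX natB -natrX ler_nat.
  have := tm_lower_step R p b2 BN q0 tN cond.
  rewrite -lE -/d natB => h; apply: le_trans h _; apply: ler_wpM2r => //.
  have [T tT] : exists T, t = T.+1 by exists t.-1; rewrite prednK.
  have := below T; rewrite tT ltnSn -(ler_nat R) !natrM !natrX => /(_ isT) h.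
  have -> : 2 * (18 * B%:R) ^+ T.+2 * q%:R =
    (2 * 18 ^+ T.+2 * B%:R ^+ 2 * q%:R) * B%:R ^+ T :> R.
    by rewrite exprMn !(exprSr (B%:R : R)); ring.
  have -> : 8 * q%:R ^+ 2 * 18 ^+ (2 * T.+1) * B%:R ^+ 2 =
    (2 * 18 ^+ T.+2 * B%:R ^+ 2 * q%:R) * (4 * q%:R * 18 ^+ T) :> R.
    by rewrite mul2n -addnn exprD !exprS; ring.
  by apply: ler_wpM2l => //; rewrite !mulr_ge0 ?exprn_ge0.
(* The least index exceeds the Pade table; the denominator [B ^ (2 ^ j.+1)] is then itself bounded
   in terms of [q]. *)
exists (2 ^ j.+1).-1; rewrite prednK ?expn_gt0 //.
have cb : (B ^ (2 ^ j.+1).-1 <= 4 * q * 18 ^ (2 ^ j.+1).-1)%N.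
  by apply: below; rewrite prednK ?expn_gt0.
split=> //; apply: le_trans (frac_trivial_bound b2 q0 ne) _.
apply: ler_wpM2r => //.
rewrite lE -addnS expnD exprM natB -(prednK (expn_gt0 2 j.+1 : 0 < 2 ^ j.+1)%N).
move: cb; rewrite -(ler_nat R) !natrM !natrX; move: (2 ^ j.+1).-1 => T h.
rewrite exprS mulrA; apply: le_trans (ler_wpM2l _ h) _; first by rewrite mulr_ge0.
have -> : 8 * q%:R ^+ 2 * 18 ^+ (2 * T.+1) * B%:R ^+ 2 =
  (q%:R * B%:R * (4 * q%:R * 18 ^+ T)) * (2 * 18 ^+ T.+2 * B%:R) :> R.
  by rewrite mul2n -addnn exprD !exprS; ring.
apply: ler_peMr; first by rewrite !mulr_ge0 ?exprn_ge0.
have B1 : 1 <= B%:R :> R by rewrite ler1n; lia.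
have c1 : 1 <= 18 ^+ T.+2 :> R by rewrite exprn_ege1 // ler1n.
nra.
Qed.

(** * Logarithmic estimates and the explicit approximation bound *)

Lemma expR_le_invr1B (R : realType) (x : R) : x < 1 -> expR x <= (1 - x)^-1.
Proof.
move=> x1; rewrite -[x in expR x]opprK expRN lef_pV2 ?posrE ?expR_gt0 ?subr_gt0 //.
exact: expR_ge1Dx.
Qed.

Lemma ln2_ge_half (R : realType) : 1 / 2 <= ln 2 :> R.
Proof.
rewrite -ler_expR lnK ?posrE //; apply: le_trans (expR_le_invr1B _) _; first by lra.
by rewrite (_ : (1 - 1 / 2)^-1 = 2) //; field.
Qed.

(* From e <= (6/5)^6 < 3. *)
Lemma ln3_gt1 (R : realType) : 1 < ln 3 :> R.
Proof.
rewrite -ltr_expR lnK ?posrE //.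
have -> : (1 : R) = 6%:R * 6^-1 by field.
rewrite expRM_natl; apply: le_lt_trans (_ : (6 / 5) ^+ 6 < _); last first.
  have -> : (6 / 5) ^+ 6 = ((6 / 5) ^+ 3) ^+ 2 :> R by rewrite -exprM.
  have -> : (6 / 5) ^+ 3 = 216 / 125 :> R by field.
  have [z0 z1] : 0 <= (216 / 125 : R) /\ (216 / 125 : R) <= 173 / 100 by split; lra.
  by move: (216 / 125) z0 z1 => z z0 z1; nra.
apply: lerXn2r; rewrite ?nnegrE ?expR_ge0 //.
apply: le_trans (expR_le_invr1B _) _; first by lra.
by rewrite (_ : (1 - 6^-1)^-1 = 6 / 5) //; field.
Qed.

(** Trades the constants 4, 8 and 18 for multiples of [ln b]. *)
Lemma ln_le_pow2 (R : realType) (b k : nat) (x : R) : (2 <= b)%N ->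
  0 < x -> x <= 2 ^+ k -> ln x <= k%:R * ln b%:R.
Proof.
move=> b2 x0 xk; apply: le_trans (_ : ln (2 ^+ k) <= _).
  by rewrite ler_ln ?posrE ?exprn_gt0.
rewrite lnXn // -[_ *+ k]mulr_natl; apply: ler_wpM2l => //.
by rewrite ler_ln ?posrE ?ltr0n ?ler_nat //; lia.
Qed.

(** The summand 1 keeps the bound valid for [q = 1], which occurs among the convergents. *)
Lemma tm_approx (R : realType) (b l : nat) (p : int) (q : nat) :
  (2 <= b)%N -> (0 < q)%N -> p%:~R / q%:R <> tm_prod R b l ->
  1 / (q%:R ^+ 2 * expR (88 * ln b%:R * (1 + Num.sqrt (ln q%:R)))) <
  `|tm_prod R b l - p%:~R / q%:R|.
Proof.
move=> b2 q0 ne; set d := `|_ - _|; have b0 : (0 < b)%N by lia.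
pose s : R := 1 + Num.sqrt (ln q%:R).
have q1 : 1 <= q%:R :> R by rewrite ler1n.
have b2R : 2 <= b%:R :> R by rewrite ler_nat.
have lnq0 : 0 <= ln q%:R :> R by apply: ln_ge0.
have s1 : 1 <= s by rewrite /s lerDl sqrtr_ge0.
have lnqs : ln q%:R <= s ^+ 2.
  rewrite -{1}(sqr_sqrtr lnq0) /s; have := sqrtr_ge0 (ln q%:R : R).
  by move: (Num.sqrt _) => y y0; nra.
have lnb : 1 / 2 <= ln b%:R :> R.
  by apply: le_trans (ln2_ge_half R) _; rewrite ler_ln ?posrE //; lra.
have lnb0 : 0 <= ln b%:R :> R by lra.
have d0 : 0 < d.
  by rewrite normr_gt0 subr_eq0; apply/eqP => /esym.
(* Passing from 87 to 88 makes the inequality strict. *)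
have suff_ln : - (2 * ln q%:R) - 87 * ln b%:R * s <= ln d ->
    1 / (q%:R ^+ 2 * expR (88 * ln b%:R * s)) < d.
  move=> h; rewrite mul1r -[X in X ^+ 2]lnK ?posrE; last by lra.
  rewrite -expRM_natl -expRD -expRN -[d]lnK ?posrE // ltr_expR.
  apply: lt_le_trans h; nra.
apply: suff_ln.
(* Take 2^m between 16 s and 32 s: the loss 18^(2t) B^2 is then exp (O (s log b)).
   If m > l, the denominator of tm_prod is itself that small. *)
have exm : exists m, 16 * s <= 2 ^+ m.
  exists (Num.bound (16 * s)); apply: le_trans (_ : (Num.bound (16 * s))%:R <= _).
    by apply/ltW/archi_boundP; lra.
  by rewrite -natrX ler_nat ltnW // ltn_expl.
case: (ex_minnP exm) => m ms mmin.
have m32 : 2 ^+ m <= 32 * s.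
  case: m ms mmin => [|m] ms mmin; first by rewrite expr0; lra.
  have : 2 ^+ m < 16 * s by rewrite ltNge; apply/negP => /mmin; rewrite ltnn.
  by rewrite exprS; lra.
have [lm|ml] := ltnP l m.
  have := frac_trivial_bound b2 q0 ne; rewrite -/d => h.
  have v0 : 0 < b%:R ^+ (2 ^ l.+1) :> R by rewrite exprn_gt0 //; lra.
  have : 0 <= ln (q%:R * b%:R ^+ (2 ^ l.+1) * d) by exact: ln_ge0.
  rewrite !lnM ?posrE ?mulr_gt0 ?ltr0n // lnXn; last by lra.
  have : (2 ^ l.+1)%:R <= 32 * s.
    by apply: le_trans m32; rewrite natrX ler_weXn2l // ler1n.
  rewrite -(mulr_natl (ln _)); move: (2 ^ l.+1)%:R => L Ls.
  have := ler_wpM2r lnb0 Ls; have : 0 <= s * ln b%:R by apply: mulr_ge0; lra.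
  by lra.
have m16 : 16 <= (2 : R) ^+ m by lra.
have B16 : (16 <= 2 ^ m)%N by rewrite -(ler_nat R) natrX.
have B36 : (36 <= b ^ 2 ^ m)%N.
  apply: leq_trans (_ : 2 ^ 16 <= _)%N; first by [].
  by apply: leq_trans (_ : 2 ^ 2 ^ m <= _)%N; rewrite ?leq_exp2l ?leq_exp2r //; lia.
have [t [ct]] := tm_lower b2 ml B36 q0 ne; rewrite -/d.
set M : R := 2 ^+ m in ms m32 m16 *.
have lnB : ln (b%:R ^+ (2 ^ m)) = M * ln b%:R :> R.
  by rewrite lnXn; [rewrite -(mulr_natl (ln _)) natrX | lra].
have natM : (2 ^ m)%:R = M by rewrite natrX.
clearbody M.
have l4 : ln 4 <= 2%:R * ln b%:R :> R by apply: ln_le_pow2 => //; lra.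
have l8 : ln 8 <= 3%:R * ln b%:R :> R by apply: ln_le_pow2 => //; lra.
have l18 : ln 18 <= 5%:R * ln b%:R :> R by apply: ln_le_pow2 => //; lra.
have Bp : 0 < b%:R ^+ (2 ^ m) :> R by rewrite exprn_gt0 //; lra.
have tM : t%:R * (M * ln b%:R) <= ln 4 + ln q%:R + t%:R * ln 18.
  rewrite -(ler_nat R) !natrM !natrX in ct.
  have := ct; rewrite -[X in is_true X -> _]ler_ln ?posrE ?mulr_gt0 ?exprn_gt0 ?ltr0n //.
  rewrite (lnXn _ Bp) lnB lnM ?posrE ?mulr_gt0 ?exprn_gt0 ?ltr0n // lnM ?posrE ?ltr0n //.
  by rewrite lnXn // -!(mulr_natl (ln _)) -(mulr_natl (_ * _)).
(* Since [M - 5 >= 11 s] and [ln q <= 2 s^2 ln b], one gets [11 s t <= 2 + 2 s^2 <= 4 s^2]. *)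
have ts : t%:R <= s.
  have : t%:R * (M - 5) * ln b%:R <= 2 * ln b%:R + ln q%:R.
    have := ler_wpM2l (ler0n R t) l18; lra.
  have t0 := ler0n R t; move: (t%:R) t0 => u u0 h.
  have h1 : u * (11 * s) * ln b%:R <= u * (M - 5) * ln b%:R.
    by apply: ler_wpM2r; [lra|apply: ler_wpM2l => //; lra].
  have h2 : u * (11 * s) * ln b%:R <= (2 + 2 * s ^+ 2) * ln b%:R by nra.
  have h3 : u * (11 * s) <= 2 + 2 * s ^+ 2.
    by rewrite -(ler_pM2r (_ : 0 < ln b%:R)) //; lra.
  nra.
move=> h; have : 0 <= ln (8 * q%:R ^+ 2 * 18 ^+ (2 * t.+1) * (b%:R ^+ (2 ^ m)) ^+ 2 * d).
  exact: ln_ge0.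
rewrite !lnM ?posrE ?mulr_gt0 ?exprn_gt0 ?ltr0n // !lnXn ?exprn_gt0 ?ltr0n //; try lra.
rewrite -!(mulr_natl (ln _)) natM natrM -[t.+1%:R]natr1.
(* The constant is [87 = 3 + 20 + 64], from [ln 8], [2 (t + 1) ln 18] and [2 M ln b]. *)
have h1 : (t%:R + 1) * ln 18 <= (2 * s) * (5 * ln b%:R).
  by apply: ler_pM => //; rewrite ?addr_ge0 ?ln_ge0 ?ler1n //; lra.
have h2 := ler_wpM2r lnb0 m32; have h3 := ler_wpM2r lnb0 s1.
by lra.
Qed.

(** * Continued fractions *)

(** Here [p / q] and [p' / q'] are consecutive convergents and [th] is the complete quotient at [j].
    The start is [0 / 1] and [1 / 0], so [q'] may be 0; the disjunction is the alternating
    determinant, written without subtraction. *)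
Lemma cf_complete_quotient (R : realType) (a : seq nat) j :
  all (fun n => 0 < n)%N a -> (j < size a)%N ->
  exists (p q p' q' : nat) (th : R),
    [/\ (0 < q)%N, (p' * q = p * q' + 1 \/ p * q' = p' * q + 1)%N,
        (nth 0%N a j)%:R <= th, 1 <= th &
        cf_frac R a = (p%:R * th + p'%:R) / (q%:R * th + q'%:R)].
Proof.
elim: a j => [|a1 a IH] //= [|j] /andP[a1_gt0 a_gt0] ja.
  exists 0%N, 1%N, 1%N, 0%N, (a1%:R + cf_frac R a).
  have [c0 _] := cf_frac_gt0 R a_gt0; have : 1 <= a1%:R :> R by rewrite ler1n.
  split=> //=; [by left|by lra|by lra|by rewrite mul0r add0r !mul1r addr0].
have [p [q [p' [q' [th [q0 pq hth th1 ->]]]]]] := IH j a_gt0 ja.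
exists q, (a1 * q + p)%N, q', (a1 * q' + p')%N, th; split=> //=.
- by rewrite addn_gt0 muln_gt0 a1_gt0 q0.
- by case: pq => E; [right|left]; nia.
have qR : 1 <= q%:R :> R by rewrite ler1n.
have q'R := ler0n R q'.
have d0 : 0 < q%:R * th + q'%:R by nra.
rewrite !natrD !natrM -[RHS]invf_div; congr (_^-1); field.
by rewrite gt_eqF.
Qed.

(** By the determinant identity the error is exactly [1 / (q (q th + q'))], and [th] is at least the
    partial quotient. *)
Lemma cf_convergent (R : realType) (a : seq nat) j :
  all (fun n => 0 < n)%N a -> (j < size a)%N ->
  exists p q : nat, [/\ (0 < q)%N, p%:R / q%:R <> cf_frac R a &
    `|cf_frac R a - p%:R / q%:R| * ((nth 0%N a j)%:R * q%:R ^+ 2) <= 1].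
Proof.
move=> a_gt0 ja.
have [p [q [p' [q' [th [q0 pq hth th1 E]]]]]] := cf_complete_quotient R a_gt0 ja.
exists p, q.
have qR : 1 <= q%:R :> R by rewrite ler1n.
have q'R := ler0n R q'.
have d0 : 0 < q%:R * th + q'%:R by nra.
have dE : `|cf_frac R a - p%:R / q%:R| = (q%:R * (q%:R * th + q'%:R))^-1.
  have -> : cf_frac R a - p%:R / q%:R =
      (p'%:R * q%:R - p%:R * q'%:R) / (q%:R * (q%:R * th + q'%:R)).
    by rewrite E; field; rewrite !gt_eqF //; lra.
  rewrite normrM normfV [X in _ / X]gtr0_norm; last by nra.
  have -> : `|p'%:R * q%:R - p%:R * q'%:R| = 1 :> R; last by rewrite mul1r.
  rewrite -!natrM; case: pq => ->; rewrite natrD.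
    by rewrite addrAC subrr add0r normr1.
  by rewrite opprD addrA subrr sub0r normrN1.
split=> //.
  move=> E0; move: dE; rewrite E0 subrr normr0 => /esym/eqP.
  by rewrite invr_eq0 gt_eqF //; nra.
rewrite dE mulrC ler_pdivrMr ?mul1r; last by nra.
have n0 := ler0n R (nth 0%N a j); nra.
Qed.

(** The invariant [p <= q] yields [a1 * q + p <= (a1 + 1) * q]. *)
Lemma cf_frac_den (R : realType) (a : seq nat) : all (fun n => 0 < n)%N a ->
  exists p q : nat, [/\ (0 < q)%N, (p <= q)%N, cf_frac R a = p%:R / q%:R &
    (q <= \prod_(n <- a) n.+1)%N].
Proof.
elim: a => [_|a1 a IH] /=.
  by exists 0%N, 1%N; rewrite mul0r big_nil.
move=> /andP[a1_gt0 /IH[p [q [q0 pq E qa]]]].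
exists q, (a1 * q + p)%N; split.
- by nia.
- by nia.
- have qR : 1 <= q%:R :> R by rewrite ler1n.
  have a1R : 1 <= a1%:R :> R by rewrite ler1n.
  have pR := ler0n R p.
  rewrite E natrD natrM -[RHS]invf_div; congr (_^-1); field.
  by rewrite gt_eqF //; lra.
- by rewrite big_cons; nia.
Qed.

(** * Reduced denominator, partial quotients and length of the expansion *)

Lemma coprimez_tm_num b m k : coprimez (tm_num b m) (b%:R ^+ k).
Proof.
apply: coprimezXr; rewrite /tm_num; elim/big_ind: _ => //.
- by rewrite /coprimez gcd1z.
- by move=> x y cx cy; rewrite coprimezMl cx.
(* Each factor is -1 modulo [b], whence the Bezout coefficients. *)
move=> h _; apply/coprimezP; exists (-1, b%:R ^+ (2 ^ h).-1) => /=.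
rewrite (_ : b%:R ^+ (2 ^ h) = b%:R ^+ (2 ^ h).-1 * b%:R); first by ring.
by rewrite -exprSr prednK ?expn_gt0.
Qed.

Lemma tm_prod_den (R : realType) (b l p q : nat) : (2 <= b)%N -> (0 < q)%N ->
  tm_prod R b l = p%:R / q%:R -> (b ^ (2 ^ l.+1).-1 <= q)%N.
Proof.
move=> b2 q0 E; have := tm_prod_num R l b2.
rewrite E -(prednK (expn_gt0 2 l.+1 : 0 < 2 ^ l.+1)%N); set k := _.-1 => h.
have b0 : b%:R != 0 :> R by rewrite pnatr_eq0 -lt0n; lia.
have q0R : q%:R != 0 :> R by rewrite pnatr_eq0 -lt0n.
have {}h : (p%:R * b%:R ^+ k)%:~R = (q%:R * tm_num b l.+1)%:~R :> R.
  apply: (mulfI b0); rewrite !rmorphM rmorphXn /= !natz -!pmulrn.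
  by rewrite [RHS]mulrCA -h exprS; field.
have {}h := intr_inj h.
have : (b%:R ^+ k %| q%:R * tm_num b l.+1)%Z by rewrite -h dvdz_mull.
rewrite Gauss_dvdzl; last by rewrite coprimez_sym coprimez_tm_num.
rewrite -natrX !natz; exact: dvdn_leq.
Qed.

Lemma powR2_half (R : realType) (l : nat) : (2 `^ (l%:R / 2)) ^+ 2 = 2 ^+ l :> R.
Proof.
by rewrite -powR_mulrn ?powR_ge0 // -powRrM divfK ?powR_mulrn // pnatr_eq0.
Qed.

(** The square is [2 ^ l * ln b >= 4 / 2]. The bound absorbs additive constants into the scale
    [2 ^ (l / 2) * sqrt (ln b)]. *)
Lemma tm_scale_ge1 (R : realType) (b l : nat) : (2 <= b)%N -> (2 <= l)%N ->
  1 <= 2 `^ (l%:R / 2) * Num.sqrt (ln b%:R) :> R.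
Proof.
move=> b2 l2.
have lnb : 1 / 2 <= ln b%:R :> R.
  apply: le_trans (ln2_ge_half R) _.
  by rewrite ler_ln ?posrE ?ltr0n ?ler_nat //; lia.
have w2 : 4 <= (2 `^ (l%:R / 2)) ^+ 2 :> R.
  by rewrite powR2_half -[4]/(2 * 2)%N%:R natrM -expr2 ler_weXn2l // ler1n.
have g2 : Num.sqrt (ln b%:R) ^+ 2 = ln b%:R :> R by rewrite sqr_sqrtr //; lra.
rewrite -[X in X <= _](expr1n _ 2) -(@ler_pXn2r _ 2) ?nnegrE ?mulr_ge0 ?powR_ge0 ?sqrtr_ge0 //.
by rewrite !expr1n exprMn g2; nra.
Qed.

Lemma tm_quotient_bound (R : realType) (b l : nat) (a : seq nat) j :
  (2 <= b)%N -> (2 <= l)%N -> regular_cf (tm_prod R b l) a -> (j < size a)%N ->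
  (nth 0%N a j)%:R <=
  expR (264 * ln b%:R * (2 `^ (l%:R / 2) * Num.sqrt (ln b%:R))) :> R.
Proof.
move=> b2 l2 [a_gt0 _ aE] ja.
have [p [q [q0 ne]]] := cf_convergent R a_gt0 ja; rewrite -aE in ne *.
have n1 : 1 <= (nth 0%N a j)%:R :> R.
  by rewrite ler1n; apply: (allP a_gt0); rewrite mem_nth.
have neZ : (p%:Z)%:~R / q%:R <> tm_prod R b l by rewrite -pmulrn.
have tb := frac_trivial_bound b2 q0 neZ; have ta := tm_approx b2 q0 neZ.
rewrite -!pmulrn in tb ta; set d := `|_| in tb ta *.
set n : R := (nth _ _ _)%:R in n1 *; move=> dn.
have q1 : 1 <= q%:R :> R by rewrite ler1n.
have b2R : 2 <= b%:R :> R by rewrite ler_nat.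
have lnb : 1 / 2 <= ln b%:R :> R.
  by apply: le_trans (ln2_ge_half R) _; rewrite ler_ln ?posrE //; lra.
have v0 : 0 < b%:R ^+ (2 ^ l.+1) :> R by rewrite exprn_gt0 //; lra.
have d0 : 0 < d.
  by rewrite normr_gt0 subr_eq0; apply/eqP => /esym.
(* The trivial lower bound and the upper bound [1 / q^2] for [d] confine [q] below the
   denominator. *)
have qv : q%:R <= b%:R ^+ (2 ^ l.+1) :> R.
  have h : d * q%:R * q%:R <= d * q%:R * b%:R ^+ (2 ^ l.+1).
    apply: le_trans (_ : 1 <= _); last by lra.
    apply: le_trans dn; rewrite -mulrA; apply: ler_wpM2l; first exact: ltW.
    by rewrite -expr2 ler_peMl // exprn_ge0.
  by rewrite -(ler_pM2l (mulr_gt0 d0 (_ : 0 < q%:R))) //; lra.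
have nE : n <= expR (88 * ln b%:R * (1 + Num.sqrt (ln q%:R))).
  set e := expR _ in ta *; have e0 : 0 < e by exact: expR_gt0.
  have q2 : 0 < q%:R ^+ 2 :> R by rewrite exprn_gt0 //; lra.
  have : 1 < d * (q%:R ^+ 2 * e) by rewrite -ltr_pdivrMr // mulr_gt0.
  move=> h1; have h2 : d * q%:R ^+ 2 * n < d * q%:R ^+ 2 * e by lra.
  by rewrite ltW // -(ltr_pM2l (mulr_gt0 d0 q2)).
apply: le_trans nE _; rewrite ler_expR.
(* The 3 comes from [1 <= r] and [sqrt (ln q) <= 2 r], with [r] the scale of [tm_scale_ge1]. *)
rewrite (_ : 264 = 88 * 3); last by rewrite -natrM.
rewrite -!mulrA; apply: ler_wpM2l => //; rewrite [leRHS]mulrCA; apply: ler_wpM2l; first by lra.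
have wg := tm_scale_ge1 R b2 l2.
set r := _ * Num.sqrt (ln b%:R) in wg *.
suff : Num.sqrt (ln q%:R) <= 2 * r by lra.
have r2 : (2 * r) ^+ 2 = 2 * (2 ^ l.+1)%:R * ln b%:R.
  rewrite /r !exprMn powR2_half sqr_sqrtr; last by lra.
  by rewrite natrX [2 ^+ l.+1]exprS; ring.
rewrite -[2 * r]ger0_norm; last by lra.
rewrite -sqrtr_sqr ler_wsqrtr // r2.
apply: le_trans (_ : ln (b%:R ^+ (2 ^ l.+1)) <= _).
  by rewrite ler_ln ?posrE //; lra.
rewrite lnXn; last by lra.
rewrite -(mulr_natl (ln _)); have L0 := ler0n R (2 ^ l.+1).
by move: (2 ^ l.+1)%:R L0 => L L0; nra.
Qed.

Lemma prod_nat_le (R : realType) (a : seq nat) (c : R) :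
  (forall n, n \in a -> n%:R <= c) -> (\prod_(n <- a) n)%:R <= c ^+ size a.
Proof.
elim: a => [|n a IH] ac; first by rewrite big_nil.
rewrite big_cons natrM exprS; apply: ler_pM => //; first by rewrite ac ?mem_head.
by apply: IH => k ka; rewrite ac // in_cons ka orbT.
Qed.

Lemma tm_cf_length (R : realType) (b l : nat) (a : seq nat) :
  (2 <= b)%N -> (2 <= l)%N -> regular_cf (tm_prod R b l) a ->
  2 `^ (l%:R / 2) <= (size a)%:R * (265 * Num.sqrt (ln b%:R)) :> R.
Proof.
move=> b2 l2 ra; have [a_gt0 _ aE] := ra.
have [p [q [q0 _ E qa]]] := cf_frac_den R a_gt0.
rewrite -aE in E; have bq := tm_prod_den b2 q0 E.
have wg := tm_scale_ge1 R b2 l2.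
have b2R : 2 <= b%:R :> R by rewrite ler_nat.
have lnb : 1 / 2 <= ln b%:R :> R.
  by apply: le_trans (ln2_ge_half R) _; rewrite ler_ln ?posrE //; lra.
have w2 := powR2_half R l; have w0 : 0 < 2 `^ (l%:R / 2) :> R by exact: powR_gt0.
set w := 2 `^ _ in wg w2 w0 *; set g := Num.sqrt _ in wg *.
set E0 := 265 * ln b%:R * (w * g).
have step n : n \in a -> n.+1%:R <= expR E0.
  move=> /(nthP 0%N)[j ja <-].
  have n1 : 1 <= (nth 0%N a j)%:R :> R.
    by rewrite ler1n; apply: (allP a_gt0); rewrite mem_nth.
  have := tm_quotient_bound b2 l2 ra ja; rewrite -/w -/g => h.
  (* The extra [ln b] in 265 = 264 + 1 pays for [n + 1 <= 2 n <= b n]. *)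
  have -> : E0 = ln b%:R * (w * g) + 264 * ln b%:R * (w * g) by rewrite /E0; ring.
  rewrite expRD; apply: le_trans (_ : 2 * (nth 0%N a j)%:R <= _).
    by rewrite -natr1; lra.
  apply: ler_pM => //; apply: (le_trans b2R).
  have bE : expR (ln b%:R) = b%:R :> R by rewrite lnK // posrE; lra.
  by rewrite -[leLHS]bE ler_expR ler_peMr //; lra.
have prod_le : (\prod_(n <- a) n.+1)%:R <= expR E0 ^+ size a :> R.
  rewrite -(size_map S a) -(big_map S xpredT id).
  by apply: prod_nat_le => n /mapP[k ka ->]; apply: step.
have vq : b%:R ^+ (2 ^ l) <= expR E0 ^+ size a :> R.
  apply: le_trans prod_le; rewrite -natrX ler_nat; apply: leq_trans qa.
  apply: leq_trans bq; rewrite leq_exp2l // expnS.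
  by have := expn_gt0 2 l; lia.
have v0 : 0 < b%:R ^+ (2 ^ l) :> R by rewrite exprn_gt0 //; lra.
have : ln (b%:R ^+ (2 ^ l)) <= ln (expR E0 ^+ size a).
  by rewrite ler_ln ?posrE // exprn_gt0 ?expR_gt0.
rewrite -expRM_natl expRK lnXn; last by lra.
rewrite -(mulr_natl (ln _)) natrX -w2 /E0 => h.
have lw : 0 < ln b%:R * w by rewrite mulr_gt0 //; lra.
by rewrite -(ler_pM2l lw); lra.
Qed.

Theorem theorem1p1 (R : realType) :
  exists K : R, 0 < K /\
  forall b : nat, (2 <= b)%N ->
  exists C : R, 0 < C /\
  forall l : nat, (2 <= l)%N ->
  [/\ forall p q : int, 3 <= q ->
        p%:~R / q%:~R <> tm_prod R b l ->
        `| tm_prod R b l - p%:~R / q%:~R | >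
        1 / (q%:~R ^+ 2 *
             expR (K * ln b%:R * Num.sqrt (ln q%:~R * ln (ln q%:~R)))),
      forall a : seq nat, regular_cf (tm_prod R b l) a ->
        forall j : nat, (j < size a)%N ->
        (nth 0%N a j)%:R <=
        b%:R `^ (2 * K * Num.sqrt l%:R *
                 Num.sqrt (ln b%:R * ln (ln (3 * b%:R))) * 2 `^ (l%:R / 2)) &
      forall a : seq nat, regular_cf (tm_prod R b l) a ->
        (size a)%:R > C * 2 `^ (l%:R / 2) / Num.sqrt l%:R].
Proof.
have ln3 := ln3_gt1 R.
have c0 : 0 < ln (ln 3) :> R by exact: ln_gt0.
set c := Num.sqrt (ln (ln 3) : R).
have cgt0 : 0 < c by rewrite sqrtr_gt0.
have sqrt_lnln (x : R) : 3 <= x -> c * Num.sqrt (ln x) <= Num.sqrt (ln x * ln (ln x)).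
  move=> x3; have lx : ln 3 <= ln x by rewrite ler_ln ?posrE //; lra.
  rewrite mulrC sqrtrM; last by lra.
  by apply: ler_wpM2l; rewrite ?sqrtr_ge0 // ler_wsqrtr // ler_ln ?posrE //; lra.
(* For [q >= 3], [1 + sqrt (ln q) <= 2 sqrt (ln q)] turns 88 into 176, and division by [c]
   introduces the factor [ln (ln q) >= ln (ln 3)] under the root. *)
exists (176 / c); split; first exact: divr_gt0.
move=> b b2.
have b2R : 2 <= b%:R :> R by rewrite ler_nat.
have lnb : 1 / 2 <= ln b%:R :> R.
  by apply: le_trans (ln2_ge_half R) _; rewrite ler_ln ?posrE //; lra.
have g0 : 0 < Num.sqrt (ln b%:R) :> R by rewrite sqrtr_gt0; lra.
(* Taking 266 instead of 265 makes the inequality in (iii) strict. *)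
exists (266 * Num.sqrt (ln b%:R))^-1; split; first by rewrite invr_gt0 mulr_gt0.
move=> l l2.
have w0 : 0 < 2 `^ (l%:R / 2) :> R by exact: powR_gt0.
have sl : 1 <= Num.sqrt l%:R :> R.
  by rewrite -[X in X <= _]sqrtr1 ler_wsqrtr // ler1n; lia.
split.
- move=> p q q3 ne; have qE : q = `|q|%N by lia.
  rewrite qE -pmulrn in ne q3 *; move: `|q|%N ne q3 {qE} => {}q ne q3.
  have q3R : 3 <= q%:R :> R by rewrite ler_nat; lia.
  have q0 : (0 < q)%N by lia.
  apply: le_lt_trans (tm_approx b2 q0 ne).
  rewrite !mul1r lef_pV2 ?posrE ?mulr_gt0 ?exprn_gt0 ?expR_gt0 ?ltr0n //.
  apply: ler_wpM2l; first by rewrite exprn_ge0.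
  rewrite ler_expR.
  have lq : 1 <= ln q%:R :> R.
    by apply: le_trans (ltW ln3) _; rewrite ler_ln ?posrE //; lra.
  have sq : 1 <= Num.sqrt (ln q%:R) :> R.
    by rewrite -[X in X <= _]sqrtr1 ler_wsqrtr.
  have := sqrt_lnln _ q3R; set y := Num.sqrt (_ * _) => cy.
  have -> : 176 / c * ln b%:R * y = ln b%:R * (176 * (y / c)) by ring.
  rewrite mulrAC -mulrA [88 * _]mulrC -mulrA [leLHS]mulrC -mulrA.
  apply: ler_wpM2l; first by lra.
  have : Num.sqrt (ln q%:R) <= y / c by rewrite ler_pdivlMr // mulrC.
  lra.
- move=> a ra j ja; apply: le_trans (tm_quotient_bound b2 l2 ra ja) _.
  set w := 2 `^ _ in w0 *; rewrite /powR gt_eqF; last by lra.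
  rewrite ler_expR.
  have b3 : 3 <= 3 * b%:R :> R by lra.
  have lnln : c <= Num.sqrt (ln (ln (3 * b%:R))).
    have l3 : ln 3 <= ln (3 * b%:R) :> R by rewrite ler_ln ?posrE //; lra.
    by apply: ler_wsqrtr; rewrite ler_ln ?posrE //; lra.
  rewrite sqrtrM; last by lra.
  set g := Num.sqrt (ln b%:R) in g0 *.
  set y := Num.sqrt (ln (ln _)) in lnln *; set sq := Num.sqrt l%:R in sl *.
  have -> : 2 * (176 / c) * sq * (g * y) * w * ln b%:R =
    (ln b%:R * (w * g)) * (352 * sq * (y / c)) by ring.
  rewrite -mulrA mulrC; apply: ler_wpM2l.
    by rewrite !mulr_ge0 ?ltW //; lra.
  have yc : 1 <= y / c by rewrite ler_pdivlMr // mul1r.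
  by nra.
- move=> a ra; have := tm_cf_length b2 l2 ra.
  set w := 2 `^ _ in w0 *; set g := Num.sqrt (ln b%:R) in g0 * => h.
  have -> : (266 * g)^-1 * w / Num.sqrt l%:R = w / (266 * g * Num.sqrt l%:R).
    by rewrite [in RHS]invfM; ring.
  rewrite ltr_pdivrMr; last by rewrite !mulr_gt0 //; lra.
  have n0 : 0 < (size a)%:R :> R.
    rewrite lt_neqAle ler0n andbT; apply/eqP => E; move: h; rewrite -E mul0r; lra.
  have ng : 0 < (size a)%:R * g by rewrite mulr_gt0.
  have := ler_wpM2l (ltW ng) sl; lra.
Qed.
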